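(* Let $P_1,\dots,P_n$ be Borel probability measures on $\mathbb{R}$ satisfying $\|\mu_\infty(P_1,\dots,P_n)\|>0$. Then: (i) the conflation $\&(P_1,\dots,P_n)$ exists; (ii) for every Borel probability measure $Q$ on $\mathbb{R}$, the maximum loss between the Shannon Information of $Q$ and $P_1,\dots,P_n$ is at least $\log_2\big(\|\mu_\infty(P_1,\dots,P_n)\|^{-1}\big)$; (iii) the bound in (ii) is attained (that is, the maximum loss equals $\log_2(\|\mu_\infty(P_1,\dots,P_n)\|^{-1})$) if and only if $Q=\&(P_1,\dots,P_n)$.
   Context: $\delta_x$ is the Dirac measure at $x$, and $\|\mu\|$ is the total mass of a Borel sub-probability measure $\mu$. For Borel probability measures $P_1,\dots,P_n$ on $\mathbb{R}$ and $j\in\mathbb{N}$, define the sub-probability measure $$\mu_j(P_1,\dots,P_n)=\sum_{k\in\mathbb{Z}}\ \prod_{i=1}^n P_i\big(((k-1)2^{-j},k2^{-j}]\big)\,\delta_{k2^{-j}}.$$ As $j\to\infty$, $\mu_j(P_1,\dots,P_n)$ always converges vaguely to a sub-probability measure, denoted $\mu_\infty(P_1,\dots,P_n)$. If $\mu_j(P_1,\dots,P_n)/\|\mu_j(P_1,\dots,P_n)\|$ converges vaguely, as $j\to\infty$, to a Borel probability measure $Q$, then $Q$ is called the conflation of $P_1,\dots,P_n$ and is written $\&(P_1,\dots,P_n)$; one then says the conflation exists. Vague convergence $\nu_j\to\nu$ of sub-probability measures means $\int f\,d\nu_j\to\int f\,d\nu$ for all continuous $f$ vanishing at infinity. The Shannon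 Information of a probability measure $P$ for a Borel set $A$ is $S_P(A)=-\log_2 P(A)$ (with $-\log_2 0=+\infty$). The joint Shannon Information of $P_1,\dots,P_n$ for $A$ is $S_{\{P_1,\dots,P_n\}}(A)=\sum_{i=1}^n S_{P_i}(A)=-\log_2\prod_{i=1}^n P_i(A)$. The loss between the Shannon Information of $Q$ and $P_1,\dots,P_n$ for the event $A$ is $S_{\{P_1,\dots,P_n\}}(A)-S_Q(A)$ if $\prod_{i=1}^n P_i(A)>0$, and is $0$ if $Q(A)=\prod_{i=1}^n P_i(A)=0$; if $\prod_{i=1}^n P_i(A)=0<Q(A)$ the loss is $S_{\{P_1,\dots,P_n\}}(A)-S_Q(A)=+\infty$. The maximum loss between the Shannon Information of $Q$ and $P_1,\dots,P_n$ is the maximum (supremum) of these losses over all Borel sets $A\subset\mathbb{R}$. *)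

(* Defs.v *)
From HB Require Import structures.
From mathcomp Require Import all_boot all_order all_algebra.
From mathcomp Require Import all_classical all_reals all_analysis.

Set Implicit Arguments.
Unset Strict Implicit.
Unset Printing Implicit Defensive.

Import Order.TTheory GRing.Theory Num.Theory.
Import numFieldNormedType.Exports.

Local Open Scope classical_set_scope.
Local Open Scope ring_scope.
Local Open Scope ereal_scope.

(* [measurableTypeR R] is R with its Borel sigma-algebra.  Library measures are
   functions on all subsets of R; only their values on measurable sets are
   meaningful, so measures are compared on measurable sets and not with [=]. *)

HB.instance Definition _ d (T : measurableType d) (R : realType) :=
  gen_eqMixin (subprobability T R).
HB.instance Definition _ d (T : measurableType d) (R : realType) :=
  gen_choiceMixin (subprobability T R).

Section vague_convergence.
Context {R : realType}.
Local Notation BR := (measurableTypeR R).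

Definition mass (mu : {measure set BR -> \bar R}) : \bar R := mu setT.

Definition vanishes_at_infinity (f : R -> R) : Prop :=
  (f x @[x --> +oo%R] --> (0 : R)%R) /\ (f x @[x --> -oo%R] --> (0 : R)%R).

Definition vague_cvg (nu : nat -> {measure set BR -> \bar R})
    (mu : {measure set BR -> \bar R}) : Prop :=
  forall f : R -> R, continuous f -> vanishes_at_infinity f ->
    (\int[nu j]_(x in setT) (f x)%:E) @[j --> \oo] -->
    \int[mu]_(x in setT) (f x)%:E.

Lemma inv_mass_ge0 (mu : {measure set BR -> \bar R}) :
  (0 <= (fine (mass mu))^-1)%R.
Proof. by rewrite invr_ge0 fine_ge0// measure_ge0. Qed.

(* The null measure if [mass mu = 0], since 0^-1 = 0 in R. *)
Definition normalized (mu : {measure set BR -> \bar R}) :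
    {measure set BR -> \bar R} :=
  mscale (NngNum (inv_mass_ge0 mu)) mu.

End vague_convergence.

Section atoms.
Context {R : realType} {n : nat} (P : 'I_n -> probability (measurableTypeR R) R).
Variable j : nat.
Local Notation BR := (measurableTypeR R).

Definition dyadic (k : int) : R := (k%:~R / 2 ^+ j)%R.

Definition weight (k : int) : \bar R :=
  \prod_(i < n) P i `](dyadic (k - 1)), (dyadic k)]%classic.

Definition mu_dyadic (A : set BR) : \bar R :=
  \esum_(k in [set: int]) (weight k * \d_(dyadic k : BR) A).

Let weight_ge0 k : 0 <= weight k.
Proof. by apply: prode_ge0 => i _; exact: measure_ge0. Qed.

Let atom_ge0 k A : 0 <= weight k * \d_(dyadic k : BR) A.
Proof. exact: mule_ge0. Qed.

Let mu_dyadic0 : mu_dyadic set0 = 0.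
Proof. by rewrite /mu_dyadic esum1// => k _; rewrite measure0 mule0. Qed.

Let mu_dyadic_ge0 A : 0 <= mu_dyadic A.
Proof. by apply: esum_ge0 => k _; exact: atom_ge0. Qed.

Let mu_dyadic_sigma_additive : semi_sigma_additive mu_dyadic.
Proof.
move=> F mF tF mUF.
suff -> : mu_dyadic (\bigcup_i F i) = \sum_(0 <= i <oo) mu_dyadic (F i).
  by apply: is_cvg_nneseries => i _ _; exact: mu_dyadic_ge0.
rewrite nneseries_esumT//.
transitivity (\esum_(k in [set: int]) \esum_(i in [set: nat])
    (weight k * \d_(dyadic k : BR) (F i))).
  apply: eq_esum => k _.
  rewrite -nneseries_esumT; last by move=> i; exact: atom_ge0.
  rewrite -(@fineK _ (weight k)); last first.
    by apply: prode_fin_num => i _; exact: fin_num_measure.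
  rewrite nneseriesZl//; congr (_ * _).
  by apply/esym/cvg_lim => //; exact: measure_semi_sigma_additive.
rewrite /mu_dyadic !esum_esum//.
rewrite (reindex_esum [set: nat * int] _ (fun x => (x.2, x.1)))//=.
  by congr esum; apply/seteqP; split.
split => //= [[? ?] [? ?] _ _ [-> ->]//|[k i] _].
by exists (i, k).
Qed.

HB.instance Definition _ := isMeasure.Build _ _ _ mu_dyadic
  mu_dyadic0 mu_dyadic_ge0 mu_dyadic_sigma_additive.

End atoms.

Section conflation.
Context {R : realType} {n : nat} (P : 'I_n -> probability (measurableTypeR R) R).
Local Notation BR := (measurableTypeR R).

(* The null measure, of mass 0, if there were no limit; the limit is unique on
   Borel sets. *)
Definition mu_infty : subprobability BR R :=
  xget (@mzero _ BR R : subprobability BR R)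
    [set mu : subprobability BR R | vague_cvg (mu_dyadic P) mu].

Definition is_conflation (Q : probability BR R) : Prop :=
  vague_cvg (fun j => normalized (mu_dyadic P j)) Q.

Definition conflation_exists : Prop := exists Q, is_conflation Q.

(* An arbitrary probability measure if the conflation does not exist; the
   conflation is unique on Borel sets. *)
Definition conflation : probability BR R := get is_conflation.

End conflation.

Section shannon.
Context {R : realType}.
Local Notation BR := (measurableTypeR R).

Definition log2 (x : \bar R) : \bar R := lne x / (ln 2)%:E.

Definition shannon (Q : probability BR R) (A : set BR) : \bar R :=
  - log2 (Q A).

Definition joint_shannon {n : nat} (P : 'I_n -> probability BR R)
    (A : set BR) : \bar R :=
  \sum_(i < n) shannon (P i) A.

(* If the product is 0 and Q A is not, the joint information is +oo and that of
   Q is finite, so that the difference is +oo. *)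
Definition shannon_loss {n : nat} (Q : probability BR R)
    (P : 'I_n -> probability BR R) (A : set BR) : \bar R :=
  if (\prod_(i < n) P i A == 0) && (Q A == 0) then 0
  else joint_shannon P A - shannon Q A.

Definition max_loss {n : nat} (Q : probability BR R)
    (P : 'I_n -> probability BR R) : \bar R :=
  ereal_sup [set shannon_loss Q P A | A in measurable].

End shannon.

(* Main.v *)
From HB Require Import structures.
Require Import Defs.
From mathcomp Require Import all_boot all_order all_algebra.
From mathcomp Require Import all_classical all_reals all_analysis measurable_realfun.
From mathcomp Require Import ring lra.

(** Write [mu] for the vague limit of the dyadic measures [mu_j], [m] for its
    mass, and [Pi A] for the product of the [P i A].  The argument rests on an
    extremal description of [mu]: it is the largest finite measure dominated by
    the set function [Pi].

    That [mu <= Pi] on Borel sets ([vague_limit_le_prod]): [mu_j] puts at the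
    right endpoint of a dyadic cell the value of [Pi] on that cell, so by
    additivity of a single factor, [mu_j B] is at most [Pi] of any set that
    contains all the cells with right endpoint in [B] ([mu_dyadic_le]).  For [K]
    closed and bounded, letting [j] tend to infinity bounds [mu K] by [Pi] of
    arbitrarily small thickenings of [K], hence by [Pi K].

    That [nu <= mu] as soon as [nu <= Pi] on dyadic cells ([le_vague_limit]):
    summing over the cells that meet [K] bounds [nu K] by the [mu_j]-mass of a
    small thickening of [K] ([le_mu_dyadic]), and [j] tends to infinity again.

    In both cases the passage to the limit uses continuous functions squeezed
    between the indicators of two thickenings ([bump_function]), and inner
    regularity of finite measures extends an inequality from closed bounded sets
    to Borel sets ([le_measure_closed_bounded]).

    The masses of the [mu_j] converge to [m] ([cvg_mass_mu_dyadic]), since far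
    from the origin [mu_j] is bounded by one of the [P i], so no mass escapes.
    The normalized measures therefore converge to [mu / m], which is the
    conflation.

    For [c > 0], the maximum loss is at most [log2 (1 / c)] exactly when
    [c Q <= Pi] on Borel sets ([max_loss_le_log2]); this implies [c Q <= mu],
    and evaluation at the whole line gives [c <= m], which is the lower bound on
    the loss.  If the loss equals [log2 (1 / m)], then [m Q <= mu], that is
    [Q <= mu / m]; two comparable probability measures are equal, so [Q] is the
    conflation.  Conversely [m (mu / m) = mu <= Pi]. *)

Set Implicit Arguments.
Unset Strict Implicit.
Unset Printing Implicit Defensive.

Import Order.TTheory GRing.Theory Num.Theory.
Import numFieldNormedType.Exports.

Local Open Scope classical_set_scope.
Local Open Scope ereal_scope.

(** * Limits and products of extended reals *)

Section ereal_cvg.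
Context {R : realType} {T : Type} {F : set_system T} {FF : Filter F}.
Implicit Types (f : T -> \bar R) (l c : \bar R).

Lemma cvge_near_lt f l c : f x @[x --> F] --> l -> l < c ->
  \forall x \near F, f x < c.
Proof.
move=> fl lc; apply: (fl [set y | y < c]); apply: open_nbhs_nbhs; split => //.
exact: open_ereal_lt_ereal.
Qed.

Lemma cvge_near_gt f l c : f x @[x --> F] --> l -> c < l ->
  \forall x \near F, c < f x.
Proof.
move=> fl lc; apply: (fl [set y | c < y]); apply: open_nbhs_nbhs; split => //.
exact: open_ereal_gt_ereal.
Qed.

End ereal_cvg.

Lemma near_pow2 {R : realType} (e : R) : (0 < e)%R ->
  \forall j \near \oo, ((2 ^+ j)^-1 < e)%R.
Proof.
move=> e0; have := near_infty_natSinv_expn_lt (PosNum e0).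
by apply: filterS => j; rewrite div1r.
Qed.

Lemma lee_prode {R : realDomainType} (I : Type) (s : seq I)
    (f g : I -> \bar R) :
  (forall i, 0 <= f i) -> (forall i, f i <= g i) ->
  \prod_(i <- s) f i <= \prod_(i <- s) g i.
Proof.
move=> f0 fg; elim: s => [|i s ih]; first by rewrite !big_nil.
by rewrite !big_cons lee_pmul// prode_ge0.
Qed.

Lemma cvge_prod {R : realType} {I : Type} (s : seq I)
    (f : nat -> I -> \bar R) (l : I -> \bar R) :
  (forall i, l i \is a fin_num) ->
  (forall i, f k i @[k --> \oo] --> l i) ->
  \prod_(i <- s) f k i @[k --> \oo] --> \prod_(i <- s) l i.
Proof.
move=> lfin fl; elim: s => [|i s ih].
  by rewrite big_nil; under eq_fun do rewrite big_nil; exact: cvg_cst.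
rewrite big_cons; under eq_fun do rewrite big_cons.
by apply: cvgeM => //; apply: mule_def_fin => //; exact: prode_fin_num.
Qed.

(** * Thickenings and bump functions *)

Section thickening.
Context {R : realType}.
Implicit Types (K : set R) (x y e M : R).

(** Open [e]-thickening of [K]: points at distance less than [e] from [K]. *)
Definition thickening K e : set R :=
  [set x | exists2 y, K y & (`|x - y| < e)%R].

Lemma open_thickening K e : open (thickening K e).
Proof.
rewrite (_ : thickening K e = \bigcup_(y in K) ball y e).
  by apply: bigcup_open => y _; exact: ball_open.
by apply/seteqP; split=> x [y Ky xy]; exists y => //; move: xy;
  rewrite /ball/= distrC.
Qed.

Lemma sub_thickening K e : (0 < e)%R -> K `<=` thickening K e.
Proof. by move=> e0 x Kx; exists x => //; rewrite subrr normr0. Qed.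

Lemma le_thickening K e e' :
  (e <= e')%R -> thickening K e `<=` thickening K e'.
Proof. by move=> ee' x [y Ky xy]; exists y => //; exact: lt_le_trans ee'. Qed.

Lemma thickeningD K e e' :
  thickening (thickening K e) e' `<=` thickening K (e + e').
Proof.
move=> x [y [z Kz yz] xy]; exists z => //.
rewrite -(subrKA y) addrC (le_lt_trans (ler_normD _ _))// addrC.
by rewrite addrC ltrD.
Qed.

Lemma measurable_thickening K e :
  measurable (thickening K e : set (measurableTypeR R)).
Proof. by apply: open_measurable; exact: open_thickening. Qed.

Lemma bigcap_thickening K : closed K ->
  \bigcap_n thickening K n.+1%:R^-1 = K.
Proof.
move=> cK; apply/seteqP; split=> [x Kx|x Kx n _]; last first.
  exact: sub_thickening.
apply: cK => B /nbhs_ballP[e /= e0 eB].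
have [N Ne] : exists N : nat, (N.+1%:R^-1 < e)%R.
  have [N _ NP] := near_infty_natSinv_lt (PosNum e0).
  by exists N; apply: NP => /=.
have [y Ky xy] := Kx N Logic.I.
exists y; split => //; apply: eB; rewrite /ball/=; exact: lt_trans Ne.
Qed.

(** Distance from [x] to the set [K]; meaningful when [K] is nonempty. *)
Definition dist_to K x : R := inf [set `|x - y|%R | y in K].

Section dist_to.
Context {K : set R} (K0 : K !=set0).

Let has_inf_dist x : has_inf [set `|x - y|%R | y in K].
Proof.
split; first by have [y Ky] := K0; exists `|x - y|%R, y.
by exists 0%R => _ [y _ <-].
Qed.

Lemma dist_to_le x y : K y -> (dist_to K x <= `|x - y|)%R.
Proof. by move=> Ky; apply: ge_inf; [exact: (has_inf_dist x).2|exists y]. Qed.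

Lemma dist_to_lt x e : (dist_to K x < e)%R -> thickening K e x.
Proof.
rewrite -subr_gt0 => /inf_adherent/(_ (has_inf_dist x))[_ [y Ky <-]].
by rewrite subrKC; exists y.
Qed.

Lemma dist_to_lipschitz x y : (dist_to K x <= dist_to K y + `|x - y|)%R.
Proof.
rewrite -lerBlDr; apply: lb_le_inf; first exact: (has_inf_dist y).1.
move=> _ [z Kz <-]; rewrite lerBlDr (le_trans (dist_to_le x Kz))//.
by rewrite -(subrKA y) addrC ler_normD.
Qed.

Lemma continuous_dist_to : continuous (dist_to K).
Proof.
move=> x; apply/cvgrPdist_lt => e e0; near=> y.
have xy : (`|x - y| < e)%R by near: y; exact: cvgr_dist_lt.
apply: le_lt_trans xy; have := dist_to_lipschitz x y.
have := dist_to_lipschitz y x; rewrite distrC ler_norml; lra.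
Unshelve. all: by end_near. Qed.

End dist_to.

(** A continuous function of bounded support squeezed between the indicators of
    two thickenings of a bounded set: a truncated affine function of the
    distance to [K]. *)
Lemma bump_function K M e : (0 < e)%R -> K `<=` [set x | (`|x| <= M)%R] ->
  exists f : R -> R, [/\ continuous f, vanishes_at_infinity f,
    forall x, (\1_(thickening K e) x <= f x)%R &
    forall x, (f x <= \1_(thickening K (2 * e)) x)%R].
Proof.
move=> e0 KM; have [->|K0] := eqVneq K set0.
  have th0 c : thickening set0 c = set0 by rewrite -subset0 => x [].
  exists (cst 0%R); rewrite !th0; split => [|||].
  - exact: cst_continuous.
  - by split; exact: cvg_cst.
  - by move=> x; rewrite indic0.
  - by move=> x; rewrite indic0.
move/set0P in K0.
pose f x := (Num.min 1 (Num.max 0 (2 - e^-1 * dist_to K x)))%R.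
have f0 x : (0 <= f x)%R by rewrite /f le_min ler01 le_max lexx.
have f1 x : (f x <= 1)%R by rewrite /f ge_min lexx.
have fout x : ~ thickening K (2 * e) x -> f x = 0%R.
  move=> Kx; have : (2 * e <= dist_to K x)%R.
    by rewrite leNgt; apply/negP => /(dist_to_lt K0).
  rewrite -ler_pdivlMr// mulrC => h.
  by rewrite /f max_l ?subr_le0// min_r.
have fM x : (M + 2 * e <= `|x|)%R -> f x = 0%R.
  move=> xM; apply: fout => -[y /KM/= yM xy].
  have := ler_distD 0%R x y; rewrite subr0 sub0r normrN.
  have := lerB_dist x y; lra.
exists f; split.
- move=> x.
  apply: (@continuous_min R R (cst 1%R) _ x); first exact: cvg_cst.
  apply: (@continuous_max R R (cst 0%R) _ x); first exact: cvg_cst.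
  apply: cvgB; first exact: cvg_cst.
  by apply: cvgM; [exact: cvg_cst|exact: continuous_dist_to].
- split; apply: cvg_near_cst; near=> x; apply: fM.
    by apply: le_trans (ler_norm x); near: x; exact/nbhs_pinfty_ge/num_real.
  rewrite -normrN; apply: le_trans (ler_norm _); rewrite lerNr.
  by near: x; exact/nbhs_ninfty_le/num_real.
- move=> x; rewrite indicE; case: (boolP (_ \in _)) => [|_]//.
  rewrite inE => -[y Ky xy]; rewrite /f le_min lexx/= le_max.
  apply/orP; right; rewrite lerBrDl -lerBrDr.
  have -> : (2 - 1 = 1 :> R)%R by lra.
  by rewrite ler_pdivrMl// mulr1 (le_trans (dist_to_le K0 _ Ky))// ltW.
- move=> x; rewrite indicE; case: (boolP (_ \in _)) => [_|]; first exact: f1.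
  by rewrite notin_setE => /fout ->.
Unshelve. all: by end_near. Qed.

End thickening.

(** * Regularity of finite Borel measures *)

Section finite_borel_measures.
Context {R : realType}.
Local Notation BR := (measurableTypeR R).
Implicit Types (nu : {finite_measure set BR -> \bar R}%R) (K : set R).

Lemma cvg_measure_thickening nu K : closed K ->
  nu (thickening K k.+1%:R^-1) @[k --> \oo] --> nu K.
Proof.
move=> cK; rewrite -[in X in _ --> X](bigcap_thickening cK).
apply: nonincreasing_cvg_mu.
- by rewrite ltey_eq fin_num_measure//; exact: measurable_thickening.
- by move=> k; exact: measurable_thickening.
- by apply: bigcapT_measurable => k; exact: measurable_thickening.
- move=> k l kl; apply/subsetPset; apply: le_thickening.
  by rewrite lef_pV2 ?posrE// ler_nat.
Qed.

(** Sets that are sandwiched between a closed and an open set whose difference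
    has arbitrarily small measure. *)
Definition approximable nu : set (set BR) :=
  [set A | forall e : R, (0 < e)%R -> exists F U : set R,
     [/\ closed F, open U, F `<=` A, A `<=` U & nu (U `\` F) < e%:E]].

Lemma approximable_closed nu K : closed K -> approximable nu K.
Proof.
move=> cK e e0.
have mK : measurable (K : set BR) by exact: closed_measurable.
have nuK : nu K \is a fin_num by exact: fin_num_measure.
have : nu K < nu K + e%:E by rewrite lteDl.
move=> /(cvge_near_lt (cvg_measure_thickening cK)).
move=> [k _ /(_ k (leqnn k))/= ke].
exists K, (thickening K k.+1%:R^-1); split => //.
- exact: open_thickening.
- exact: sub_thickening.
- rewrite measureD//; last 2 first.
    exact: measurable_thickening.
    by rewrite ltey_eq fin_num_measure//; exact: measurable_thickening.
  rewrite setIidr; last exact: sub_thickening.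
  by rewrite lteBlDl.
Qed.

Lemma approximable_setC nu A : approximable nu A -> approximable nu (~` A).
Proof.
move=> nuA e e0; have [F [U [cF oU FA AU FUe]]] := nuA _ e0.
exists (~` U), (~` F); split.
- exact: open_closedC.
- exact: closed_openC.
- exact: subsetC.
- exact: subsetC.
- by rewrite setDE setCK setIC -setDE.
Qed.

Lemma approximable_bigcup nu (A : (set BR)^nat) :
  (forall k, approximable nu (A k)) -> approximable nu (\bigcup_k A k).
Proof.
move=> nuA e e0.
have e20 (k : nat) : (0 < (e / 2) / (2 ^ k.+1)%:R :> R)%R.
  by rewrite !divr_gt0// ltr0n expn_gt0.
have /choice[FU FUP] : forall k, exists FU : set R * set R,
    [/\ closed FU.1, open FU.2, FU.1 `<=` A k, A k `<=` FU.2 &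
      nu (FU.2 `\` FU.1) < ((e / 2) / (2 ^ k.+1)%:R)%:E].
  by move=> k; have [F [U ?]] := nuA k _ (e20 k); exists (F, U).
pose U := \bigcup_k (FU k).2; pose F m := \bigcup_(k < m) (FU k).1.
(* [\bigcup_m F m] need not be closed; a large enough finite stage [F m] is, and
   loses at most another [e / 2]. *)
have cF m : closed (F m).
  apply: closed_bigcup; first exact: finite_II.
  by move=> k _; have [] := FUP k.
have oU : open U by apply: bigcup_open => k _; have [] := FUP k.
have mU : measurable (U : set BR) by exact: open_measurable.
have mF m : measurable (F m : set BR) by exact: closed_measurable.
have mFU k : measurable ((FU k).2 `\` (FU k).1 : set BR).
  have [? ? _ _ _] := FUP k.
  by apply: measurableD; [exact: open_measurable|exact: closed_measurable].
have UFe : nu (U `\` \bigcup_m F m) <= (e / 2)%:E.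
  apply: le_trans (epsilon_trick0 xpredT _); last by rewrite divr_ge0// ltW.
  apply: (@le_trans _ _ (\sum_(k <oo) nu ((FU k).2 `\` (FU k).1))).
    apply: measure_sigma_subadditive => //.
      by apply: measurableD => //; exact: bigcupT_measurable.
    move=> x [[k _ Ux] nFx]; exists k => //; split => // Fx; apply: nFx.
    by exists k.+1 => //; exists k => /=.
  by apply: lee_nneseries => // k _; apply: ltW; have [] := FUP k.
have : nu (U `\` F m) @[m --> \oo] --> nu (U `\` \bigcup_m F m).
  have UF : U `\` \bigcup_m F m = \bigcap_m (U `\` F m).
    apply/seteqP; split=> [x [Ux nFx] m _|x UFx].
      by split => // Fx; apply: nFx; exists m.
    split; first by have [] := UFx 0%N Logic.I.
    by move=> [m _]; have [_] := UFx m Logic.I.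
  rewrite UF.
  apply: nonincreasing_cvg_mu.
  - by rewrite ltey_eq fin_num_measure//; apply: measurableD.
  - by move=> m; apply: measurableD.
  - by apply: bigcapT_measurable => m; apply: measurableD.
  - move=> k l kl; apply/subsetPset; apply: setDS => x [i /= ik Fx].
    by exists i => //=; exact: leq_trans kl.
have UFe' : nu (U `\` \bigcup_m F m) < e%:E.
  by rewrite (le_lt_trans UFe)// lte_fin; lra.
move/cvge_near_lt => /(_ _ UFe')[m _ /(_ m (leqnn m))/= UFm].
exists (F m), U; split => //.
- by move=> x [k _ Fx]; exists k => //; have [_ _ + _ _] := FUP k; exact.
- by move=> x [k _ Ax]; exists k => //; have [_ _ _ + _] := FUP k; exact.
Qed.

Lemma measurable_approximable nu A : measurable A -> approximable nu A.
Proof.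
move=> mA.
have : (@RGenOpens.G R).-sigma.-measurable A.
  by rewrite -RGenOpens.measurableE.
apply: smallest_sub.
  split.
  - by apply: approximable_closed; exact: closed0.
  - by move=> B /approximable_setC; rewrite setTD.
  - by move=> B; exact: approximable_bigcup.
move=> _ [x [y ->]]; rewrite -[X in approximable _ X]setCK.
apply: approximable_setC; apply: approximable_closed; apply: open_closedC.
exact: interval_open.
Qed.

(** A bound on closed bounded sets by a monotone set function extends to all
    Borel sets, by inner regularity. *)
Lemma le_measure_closed_bounded nu (phi : set BR -> \bar R) :
  (forall A B, measurable A -> measurable B -> A `<=` B -> phi A <= phi B) ->
  (forall K (M : R), closed K -> K `<=` [set x | (`|x| <= M)%R] ->
    nu K <= phi K) ->
  forall A, measurable A -> nu A <= phi A.
Proof.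
move=> phi_le nuphi A mA.
apply/lee_addgt0Pr => e e0.
have [F [U [cF oU FA AU UFe]]] := measurable_approximable nu mA e0.
have mF : measurable (F : set BR) by exact: closed_measurable.
have mU : measurable (U : set BR) by exact: open_measurable.
have nuF : nu F <= phi A.
  pose G k : set BR := F `&` `[(- k%:R)%R, k%:R%R].
  have cG k : closed (G k : set R).
    by apply: closedI => //; exact: interval_closed.
  have mG k : measurable (G k) by exact: closed_measurable.
  have : nu (G k) @[k --> \oo] --> nu F.
    have FG : F = \bigcup_k G k.
      apply/seteqP; split=> [x Fx|x [k _ []//]].
      exists (Num.truncn `|x|).+1 => //; split => //=.
      by rewrite in_itv/= -ler_norml ltW// truncnS_gt.
    rewrite [in X in _ --> X]FG; apply: nondecreasing_cvg_mu => //.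
    - by rewrite -FG.
    - move=> k l kl; apply/subsetPset; apply: setIS => x /=; rewrite !in_itv/=.
      by rewrite -!ler_norml => /le_trans; apply; rewrite ler_nat.
  move/cvge_to_le; apply; near=> k.
  apply: (@le_trans _ _ (phi (G k))); last first.
    by apply: phi_le => // x [/FA].
  apply: (@nuphi _ k%:R%R) => // x [_] /=.
  by rewrite in_itv/= -ler_norml.
have -> : A = F `|` A `\` F by rewrite setDUK.
rewrite measureU//; last 2 first.
- exact: measurableD.
- by rewrite setDIK.
rewrite setDUK// leeD//.
apply: le_trans (ltW UFe); apply: le_measure; rewrite ?inE.
- exact: measurableD.
- exact: measurableD.
- exact: setSD.
Unshelve. all: by end_near. Qed.

End finite_borel_measures.

(** * Vague convergence *)

Section vague_limits.
Context {R : realType}.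
Local Notation BR := (measurableTypeR R).
Implicit Types (nu : nat -> {measure set BR -> \bar R}%R)
  (mu : {measure set BR -> \bar R}%R) (K : set R) (M e : R) (c : \bar R).

Lemma le_integral_indic mu (A B : set BR) (f : R -> R) : continuous f ->
  measurable A -> measurable B ->
  (forall x, (\1_A x <= f x)%R) -> (forall x, (f x <= \1_B x)%R) ->
  mu A <= \int[mu]_x (f x)%:E <= mu B.
Proof.
move=> cf mA mB Af fB.
have mf : measurable_fun [set: BR] (EFin \o (f : BR -> R)).
  by apply/measurable_EFinP; exact: continuous_measurable_fun.
have mi D : measurable D -> measurable_fun [set: BR] (EFin \o (\1_D : BR -> R)%R).
  by move=> mD; exact/measurable_EFinP/measurable_indic.
have f0 x : (0 <= f x)%R by exact: le_trans (Af x).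
apply/andP; split.
- rewrite -[A]setIT -integral_indic//.
  apply: ge0_le_integral => //; first exact: mi.
  by move=> x _; rewrite lee_fin; exact: Af.
- rewrite -[B]setIT -integral_indic//.
  apply: ge0_le_integral => //; [|exact: mi|].
    by move=> x _; rewrite lee_fin; exact: f0.
  by move=> x _; rewrite lee_fin; exact: fB.
Qed.

(** The next two lemmas are the form of the portmanteau theorem used below. *)
Lemma vague_cvg_near_gt nu mu K M e c : vague_cvg nu mu -> (0 < e)%R ->
  K `<=` [set x | (`|x| <= M)%R] -> c < mu (thickening K e) ->
  \forall j \near \oo, c < nu j (thickening K (2 * e)).
Proof.
move=> numu e0 KM cK; have [f [cf f0 Kf fK]] := bump_function e0 KM.
have mK d := measurable_thickening K d.
have cf' : c < \int[mu]_x (f x)%:E.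
  by have /andP[+ _] := le_integral_indic mu cf (mK e) (mK _) Kf fK;
    exact: lt_le_trans.
have := cvge_near_gt (numu f cf f0) cf'; apply: filterS => j /lt_le_trans; apply.
by have /andP[] := le_integral_indic (nu j) cf (mK e) (mK _) Kf fK.
Qed.

Lemma vague_cvg_near_lt nu mu K M e c : vague_cvg nu mu -> (0 < e)%R ->
  K `<=` [set x | (`|x| <= M)%R] -> mu (thickening K (2 * e)) < c ->
  \forall j \near \oo, nu j (thickening K e) < c.
Proof.
move=> numu e0 KM cK; have [f [cf f0 Kf fK]] := bump_function e0 KM.
have mK d := measurable_thickening K d.
have cf' : \int[mu]_x (f x)%:E < c.
  by have /andP[_ +] := le_integral_indic mu cf (mK e) (mK _) Kf fK;
    move/le_lt_trans; apply.
have := cvge_near_lt (numu f cf f0) cf'; apply: filterS => j; apply: le_lt_trans.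
by have /andP[] := le_integral_indic (nu j) cf (mK e) (mK _) Kf fK.
Qed.

(** Domination on thickenings of closed bounded sets gives domination on Borel
    sets. *)
Lemma le_measure_thickening (mu1 mu2 : {finite_measure set BR -> \bar R}%R) :
  (forall K M e, closed K -> (0 < e)%R -> K `<=` [set x | (`|x| <= M)%R] ->
    mu1 K <= mu2 (thickening K (2 * e))) ->
  forall A, measurable A -> mu1 A <= mu2 A.
Proof.
move=> mu12; apply: le_measure_closed_bounded => [A B mA mB AB|K M cK KM].
  by apply: le_measure => //; rewrite inE.
apply: (cvge_to_ge (cvg_measure_thickening cK)); apply: nearW => k.
have -> : (k.+1%:R^-1 = 2 * (k.+1%:R^-1 / 2) :> R)%R.
  by rewrite mulrC divfK// pnatr_eq0.
by apply: (mu12 _ M) => //; rewrite divr_gt0.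
Qed.

Lemma vague_cvg_unique nu (mu1 mu2 : {finite_measure set BR -> \bar R}%R) :
  vague_cvg nu mu1 -> vague_cvg nu mu2 ->
  forall A, measurable A -> mu1 A = mu2 A.
Proof.
suff H (m1 m2 : {finite_measure set BR -> \bar R}%R) :
    vague_cvg nu m1 -> vague_cvg nu m2 ->
    forall A, measurable A -> m1 A <= m2 A.
  by move=> nu1 nu2 A mA; apply/eqP; rewrite eq_le !H.
move=> nu1 nu2; apply: le_measure_thickening => K M e cK e0 KM.
have [f [cf f0 Kf fK]] := bump_function e0 KM.
have mK d := measurable_thickening K d.
apply: (@le_trans _ _ (m1 (thickening K e))).
  apply: le_measure; rewrite ?inE; [exact: closed_measurable|exact: mK|].
  exact: sub_thickening.
have /andP[/le_trans + _] := le_integral_indic m1 cf (mK e) (mK _) Kf fK.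
apply; rewrite (cvg_unique _ (nu1 f cf f0) (nu2 f cf f0))//.
by have /andP[] := le_integral_indic m2 cf (mK e) (mK _) Kf fK.
Qed.

End vague_limits.

(** * Dyadic cells *)

Section dyadic_cells.
Context {R : realType}.
Local Notation BR := (measurableTypeR R).
Implicit Types (j : nat) (k : int) (x : R).

(** The dyadic interval whose mass is put at its right endpoint
    [dyadic j k]. *)
Definition cell j k : set BR := `](dyadic j (k - 1)), (dyadic j k)]%classic.

Lemma measurable_cell j k : measurable (cell j k).
Proof. exact: measurable_itv. Qed.

Let pow2_gt0 j : (0 < 2 ^+ j :> R)%R. Proof. by rewrite exprn_gt0. Qed.

Lemma cellP j k x : cell j k x <-> k = Num.ceil (x * 2 ^+ j)%R.
Proof.
rewrite /cell/= in_itv/= /dyadic ltr_pdivrMr// ler_pdivlMr//.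
split=> [kx|->]; last exact: ceil_itv.
by apply/esym/ceil_def.
Qed.

Lemma trivIset_cell j : trivIset setT (cell j).
Proof.
apply/trivIsetP => k l _ _; apply: contra_neqP => /eqP/set0P[x [kx lx]].
by move/cellP: kx => ->; move/cellP: lx => ->.
Qed.

Lemma cell_dist j k x : cell j k x -> (0 <= dyadic j k - x < (2 ^+ j)^-1)%R.
Proof.
rewrite /cell/= in_itv/= => /andP[]; rewrite /dyadic intrB mulrBl mul1r.
by move=> h1 h2; lra.
Qed.

Section sum_cells.
Variable nu : {measure set BR -> \bar R}%R.

(** The cells cover the line. *)
Lemma le_esum_cell j A : measurable A ->
  nu A <= (\esum_(k in [set: int]) nu (A `&` cell j k))%R.
Proof.
move=> mA.
have mAC k : measurable (A `&` cell j k).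
  by apply: measurableI => //; exact: measurable_cell.
(* The integer-indexed family is listed along the natural numbers; indices that
   encode no integer get the empty set. *)
pose F n : set BR := oapp (fun k => A `&` cell j k) set0 (@pickle_inv int n).
have mF n : measurable (F n).
  by rewrite /F; case: pickle_inv => [k|]; [exact: mAC|exact: measurable0].
apply: (@le_trans _ _ (\sum_(n <oo) nu (F n))).
  apply: measure_sigma_subadditive => // x Ax.
  exists (pickle (Num.ceil (x * 2 ^+ j)%R)); first exact: Logic.I.
  by rewrite /F pickleK_inv /oapp; split; [exact: Ax|exact/cellP].
rewrite nneseries_esumT//.
rewrite (esumID (range (@pickle int)))// setTI [X in _ + X]esum1.
  rewrite adde0 esum_image; last by move=> k l _ _; exact: (pcan_inj pickleK).
  by apply: le_esum => k _; rewrite /F pickleK_inv.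
move=> n [_ nP]; rewrite /F; case E : (@pickle_inv int n) => [k|/=].
  exfalso; apply: nP; exists k => //.
  by have := @pickle_invK int n; rewrite /ocancel E.
by rewrite measure0.
Qed.

Lemma fsum_cell_le j (X : set int) A : finite_set X -> measurable A ->
  (\sum_(k \in X) nu (A `&` cell j k))%R <= nu A.
Proof.
move=> finX mA; rewrite -measure_fin_bigcup//.
- apply: le_measure; rewrite ?inE//; last by move=> x [k _ []].
  apply: fin_bigcup_measurable => // k _.
  by apply: measurableI => //; exact: measurable_cell.
- apply: trivIset_setIl; apply: sub_trivIset (@trivIset_cell j). exact: subsetT.
- by move=> k _; apply: measurableI => //; exact: measurable_cell.
Qed.

End sum_cells.

End dyadic_cells.

Section mu_dyadic_bounds.
Context {R : realType} {n : nat} (P : 'I_n -> probability (measurableTypeR R) R).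
Local Notation BR := (measurableTypeR R).

Lemma weightE j k : weight P j k = \prod_(i < n) P i (cell j k).
Proof. by []. Qed.

Lemma weight_ge0 j k : 0 <= weight P j k.
Proof. by rewrite weightE; apply: prode_ge0 => i _. Qed.

(** Each weight is at most one factor on the cell times the other factors on
    [B], and the one factor is additive over the disjoint cells. *)
Lemma mu_dyadic_le j (A B : set BR) : (0 < n)%N -> measurable B ->
  (forall k, A (dyadic j k) -> cell j k `<=` B) ->
  mu_dyadic P j A <= \prod_(i < n) P i B.
Proof.
move=> n0 mB AB; pose i0 := Ordinal n0.
rewrite (bigD1 i0)//=.
set c := \prod_(i < n | i != i0) P i B.
have c0 : 0 <= c by apply: prode_ge0.
apply: ge_ereal_sup => _ [X [finX _] <-].
apply: (@le_trans _ _ (\sum_(k \in X) (P i0 (B `&` cell j k) * c)%E)%R).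
  apply: lee_fsum => // k _; rewrite diracE.
  case: (boolP (_ \in A)) => [|_]; last by rewrite mule0 mule_ge0.
  rewrite inE => /AB kB; rewrite mule1 weightE (bigD1 i0)//= setIidr//.
  apply: lee_pmul => //; first by apply: prode_ge0.
  rewrite /c !(big_mkcond (fun i => i != i0)) /=; apply: lee_prode => i.
    by case: ifP.
  by case: ifP => // _; apply: le_measure; rewrite ?inE//; exact: measurable_cell.
rewrite -ge0_mule_fsuml//; apply: lee_pmul => //.
  by apply: fsume_ge0.
exact: fsum_cell_le.
Qed.

Lemma le_mu_dyadic (nu : {measure set BR -> \bar R}%R) j (A B : set BR) :
  measurable A -> (forall k, nu (cell j k) <= weight P j k) ->
  (forall k x, cell j k x -> A x -> B (dyadic j k)) ->
  nu A <= mu_dyadic P j B.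
Proof.
move=> mA nuP AB; apply: (le_trans (le_esum_cell nu j mA)).
apply: le_esum => k _; have [Ak|] := eqVneq (A `&` cell j k) set0.
  by rewrite Ak measure0 mule_ge0// weight_ge0.
move=> /set0P[x [Ax kx]]; rewrite diracE mem_set ?mule1; last exact: AB Ax.
apply: le_trans (nuP k); apply: le_measure; rewrite ?inE.
- by apply: measurableI => //; exact: measurable_cell.
- exact: measurable_cell.
- exact: subIsetr.
Qed.

End mu_dyadic_bounds.

(** * Scaling and normalization *)

Section scaling.
Context {R : realType}.
Local Notation BR := (measurableTypeR R).

Section finite_mscale.
Context (r : {nonneg R}%R) (nu : {finite_measure set BR -> \bar R}%R).

Let mscale_fin_num : fin_num_fun (mscale r nu).
Proof. by move=> A mA; rewrite fin_numM// fin_num_measure. Qed.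

HB.instance Definition _ :=
  @Measure_isFinite.Build _ BR R (mscale r nu) mscale_fin_num.

End finite_mscale.

(** No sign or integrability condition: with nonnegative [a] and [b], scaling by
    [r >= 0] commutes with [a - b] even when both are infinite, [+oo - +oo]
    being [-oo]. *)
Lemma integral_mscale (r : {nonneg R}%R) (nu : {measure set BR -> \bar R}%R)
    (f : BR -> \bar R) : measurable_fun setT f ->
  \int[mscale r nu]_x f x = (r%:num)%R%:E * \int[nu]_x f x.
Proof.
move=> mf; rewrite [LHS]integralE [in RHS]integralE !ge0_integral_mscale//; last 2 first.
- exact: measurable_funeneg.
- exact: measurable_funepos.
have : 0 <= \int[nu]_x f^\+ x by exact: integral_ge0.
have : 0 <= \int[nu]_x f^\- x by exact: integral_ge0.
move: (\int[nu]_x f^\- x) (\int[nu]_x f^\+ x) => b a b0 a0.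
have [->|r0] := eqVneq (r%:num)%R 0%R; first by rewrite !mul0e sube0.
have rgt0 : 0 < (r%:num)%R%:E by rewrite lte_fin lt_neqAle eq_sym r0/=.
case: a b a0 b0 => [a| |] [b| |]// _ _; rewrite ?gt0_muley ?gt0_muleNy//.
  by rewrite -!EFinM -EFinB mulrBr.
Qed.

Lemma vague_cvg_normalized (nu : nat -> {measure set BR -> \bar R}%R)
    (mu : {measure set BR -> \bar R}%R) :
  0 < mass mu < +oo -> mass (nu j) @[j --> \oo] --> mass mu ->
  vague_cvg nu mu -> vague_cvg (fun j => normalized (nu j)) (normalized mu).
Proof.
move=> /andP[mu0 muoo] massE numu f cf f0.
have mf : measurable_fun [set: BR] (EFin \o (f : BR -> R)).
  by apply/measurable_EFinP; exact: continuous_measurable_fun.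
rewrite /normalized integral_mscale//.
under eq_fun do rewrite integral_mscale//=.
have finmu : mass mu \is a fin_num by rewrite ge0_fin_numE// ltW.
have fmu0 : (fine (mass mu) != 0)%R by rewrite fine_eq0// gt_eqF.
(* The scalar limit is nonzero, so the product is defined even if the integral
   of [f] were infinite. *)
apply: cvgeM; last exact: numu.
  by rewrite /mule_def/= invr_eq0 fmu0; case: (integral _ _ _).
apply: cvg_EFin; first exact: nearW.
apply: cvgV => //.
by apply: fine_cvg; rewrite fineK.
Qed.

End scaling.

(** * The vague limit of the dyadic measures *)

Section vague_limit_of_mu_dyadic.
Context {R : realType} {n : nat} (P : 'I_n -> probability (measurableTypeR R) R).
Local Notation BR := (measurableTypeR R).
Variable mu : {finite_measure set BR -> \bar R}%R.
Hypothesis mu_lim : vague_cvg (mu_dyadic P) mu.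

(** The limit is dominated by the product set function. *)
Lemma vague_limit_le_prod (A : set BR) : (0 < n)%N -> measurable A ->
  mu A <= \prod_(i < n) P i A.
Proof.
move=> n0; move: A.
apply: (@le_measure_closed_bounded _ mu (fun A => \prod_(i < n) P i A)).
  by move=> A B mA mB AB; apply: lee_prode => // i; apply: le_measure => //;
    rewrite inE.
move=> K M cK KM.
have mK : measurable (K : set BR) by exact: closed_measurable.
have mth e := @measurable_thickening _ K e.
have PK : \prod_(i < n) P i (thickening K (k.+1%:R^-1)%R) @[k --> \oo] -->
    \prod_(i < n) P i K.
  apply: (@cvge_prod _ _ _ (fun k i => P i (thickening K (k.+1%:R^-1)%R))) => i.
    exact: fin_num_measure.
  exact: cvg_measure_thickening.
apply: (cvge_to_ge PK); apply: nearW => k.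
set e : R := (k.+1%:R^-1)%R; have e0 : (0 < e)%R by rewrite invr_gt0.
(* If the bound fails at [K], it fails at [thickening K (e / 4)]; then some
   [mu_j] exceeds the bound on [thickening K (e / 2)], whereas its cells with
   right endpoint there have length less than [e / 2], hence lie in
   [thickening K e]. *)
have e40 : (0 < e / 4)%R by rewrite divr_gt0.
rewrite leNgt; apply/negP => PK_lt.
have {}PK_lt : \prod_(i < n) P i (thickening K e) < mu (thickening K (e / 4)).
  apply: (lt_le_trans PK_lt); apply: le_measure; rewrite ?inE//.
  exact: sub_thickening.
have e20 : (0 < e / 2)%R by rewrite divr_gt0.
have [j [/= h1 h2]] := filter_ex
  (filterI (vague_cvg_near_gt mu_lim e40 KM PK_lt) (near_pow2 e20)).
move: h1; apply/negP; rewrite -leNgt; apply: mu_dyadic_le => // l lK x lx.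
rewrite (_ : e = 2 * (e / 4) + e / 2)%R; last by field.
apply: thickeningD; exists (dyadic j l) => //.
have /andP[d0 d1] := cell_dist lx.
by rewrite distrC ger0_norm// (lt_trans d1).
Qed.

(** The limit is the largest measure dominated by the product set function on
    the dyadic cells. *)
Lemma le_vague_limit (nu : {finite_measure set BR -> \bar R}%R) :
  (forall j k, nu (cell j k) <= weight P j k) ->
  forall A, measurable A -> nu A <= mu A.
Proof.
move=> nuP; apply: le_measure_thickening => K M e cK e0 KM.
have mK : measurable (K : set BR) by exact: closed_measurable.
rewrite leNgt; apply/negP => muK.
have [j [/= h1 h2]] := filter_ex
  (filterI (vague_cvg_near_lt mu_lim e0 KM muK) (near_pow2 e0)).
move: h1; apply/negP; rewrite -leNgt; apply: (le_mu_dyadic mK (nuP j)) => k x kx Kx.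
exists x => //; have /andP[d0 d1] := cell_dist kx.
by rewrite ger0_norm// (lt_trans d1).
Qed.

Lemma near_measure_tail (nu : {finite_measure set BR -> \bar R}%R) (e : R) :
  (0 < e)%R ->
  \forall k \near \oo, nu (~` [set x | (`|x| <= k%:R)%R]) < e%:E.
Proof.
move=> e0; pose F k : set BR := ~` `[(- k%:R)%R, k%:R%R].
have FE k : ~` [set x : R | (`|x| <= k%:R)%R] = F k.
  by rewrite /F; congr (~` _); apply/seteqP; split=> x /=;
    rewrite in_itv/= ler_norml.
have mF k : measurable (F k) by apply: measurableC; exact: measurable_itv.
have F0 : \bigcap_k F k = set0.
  rewrite -subset0 => x Fx; apply: (Fx (Num.truncn `|x|).+1 Logic.I) => /=.
  by rewrite in_itv/= -ler_norml ltW// truncnS_gt.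
have : nu (F k) @[k --> \oo] --> nu (\bigcap_k F k).
  apply: nonincreasing_cvg_mu => //.
  - by rewrite ltey_eq fin_num_measure.
  - exact: bigcapT_measurable.
  - move=> k l kl; apply/subsetPset; apply: subsetC => x /=.
    by rewrite !in_itv/= -!ler_norml => /le_trans; apply; rewrite ler_nat.
have e0' : 0 < e%:E by rewrite lte_fin.
rewrite F0 measure0 => /cvge_near_lt/(_ e0').
by apply: filterS => k; rewrite FE.
Qed.

(** No mass escapes to infinity: outside a bounded set, the mass of the dyadic
    approximations is bounded by that of one of the factors. *)
Lemma cvg_mass_mu_dyadic : (0 < n)%N ->
  mass (mu_dyadic P j) @[j --> \oo] --> mass mu.
Proof.
move=> n0; pose i0 := Ordinal n0.
have finmu : mass mu \is a fin_num by exact: fin_num_measure.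
suff H (e : R) : (0 < e)%R -> \forall j \near \oo,
    mass mu - e%:E < mass (mu_dyadic P j) < mass mu + e%:E.
  rewrite -[X in _ --> X](fineK finmu); apply/fine_cvgP; split.
    have := H 1%R ltr01; apply: filterS => j /andP[_ /lt_trans h].
    by rewrite ge0_fin_numE// h// ltey_eq fin_numD finmu.
  apply/cvgrPdist_lt => e e0; have := H e e0; apply: filterS => j.
  rewrite -(fineK finmu) /comp; case: (mass (mu_dyadic P j)) => [r| |]; last 2 first.
  - by move=> /andP[_]; rewrite ltNge leey.
  - by rewrite ltNge leNye.
  by rewrite -EFinB -EFinD !lte_fin distrC ltr_distl.
move=> e0; have e20 : (0 < e / 2)%R by rewrite divr_gt0.
have [k [/= mue P0e]] := filter_ex (filterI (near_measure_tail mu e20)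
  (near_measure_tail (P i0) e20)).
(* [mu] and [P i0] both have mass less than [e / 2] outside [B]. *)
pose B : set R := [set x | (`|x| <= k%:R)%R].
have mB : measurable (B : set BR).
  rewrite (_ : B = `[(- k%:R)%R, k%:R%R]%classic); first exact: measurable_itv.
  by apply/seteqP; split=> x; rewrite /B/= in_itv/= ler_norml.
have BM : B `<=` [set x | (`|x| <= k%:R)%R] by [].
have mth c := @measurable_thickening _ B c.
have lowB : mass mu - e%:E < mu (thickening B 1).
  have : mu B <= mu (thickening B 1).
    by apply: le_measure; rewrite ?inE//; exact: sub_thickening.
  apply: lt_le_trans; rewrite lteBlDr// /mass -(setUv B).
  rewrite measureU ?setICr//; last exact: measurableC.
  by rewrite lteD2lE ?fin_num_measure// (lt_trans mue)// lte_fin; lra.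
have upB : mu (thickening B (2 * 1)) < mass mu + (e / 2)%:E.
  apply: (@le_lt_trans _ _ (mass mu)); last by rewrite lteDl.
  by apply: le_measure; rewrite ?inE.
near=> j; apply/andP; split.
  apply: (@lt_le_trans _ _ (mu_dyadic P j (thickening B (2 * 1)))).
    by near: j; exact: (vague_cvg_near_gt mu_lim ltr01 BM lowB).
  by apply: le_measure; rewrite ?inE.
(* The cells with right endpoint outside [thickening B 1] have length at most 1,
   so they miss [B]. *)
rewrite /mass -(setUv (thickening B 1)) measureU ?setICr//; last first.
  exact: measurableC.
rewrite [e in ltRHS]splitr EFinD addeA; apply: lteD.
  rewrite setUv; near: j; exact: (vague_cvg_near_lt mu_lim ltr01 BM upB).
apply: le_lt_trans P0e; apply: (@le_trans _ _ (\prod_(i < n) P i (~` B))).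
  apply: mu_dyadic_le => //; first exact: measurableC.
  move=> l nBl x lx Bx; apply: nBl; exists x => //.
  have /andP[d0 d1] := cell_dist lx.
  by rewrite ger0_norm// (lt_le_trans d1)// invf_le1 ?exprn_gt0// exprn_ege1// ler1n.
have mnB : measurable (~` B : set BR) by exact: measurableC.
rewrite (bigD1 i0)//= -[leRHS]mule1; apply: lee_pmul => //.
  by apply: prode_ge0.
suff /andP[] : 0 <= \prod_(i < n | i != i0) P i (~` B) <= 1 by [].
apply: (big_ind (fun x : \bar R => 0 <= x <= 1)) => [|x y|i _].
- by rewrite lee_fin ler01 lexx.
- move=> /andP[x0 x1] /andP[y0 y1]; rewrite mule_ge0//=.
  by rewrite -[leRHS]mule1 lee_pmul.
- by rewrite measure_ge0 probability_le1.
Unshelve. all: by end_near. Qed.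

End vague_limit_of_mu_dyadic.

(** * Shannon information *)

Section information.
Context {R : realType}.
Local Notation BR := (measurableTypeR R).
Implicit Types (r c : R) (x y : \bar R).

Let ln2_gt0 : (0 < ln 2 :> R)%R. Proof. by rewrite ln_gt0// ltr1n. Qed.

Lemma log2_EFin r : (0 < r)%R -> log2 r%:E = (ln r / ln 2)%:E.
Proof. by move=> r0; rewrite /log2 lne_EFin// inver gt_eqF. Qed.

Lemma log20 : log2 (0 : \bar R) = -oo.
Proof.
by rewrite /log2 le0_lneNy// inver gt_eqF// gt0_mulNye// lte_fin invr_gt0.
Qed.

Lemma log2M x y : 0 <= x < +oo -> 0 <= y < +oo ->
  - log2 (x * y) = - log2 x - log2 y.
Proof.
case: x y => [x| |] [y| |]//; rewrite ?ltxx ?andbF// !lee_fin.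
move=> /andP[x0 _] /andP[y0 _].
have [->|xn0] := eqVneq x 0%R.
  rewrite mul0e log20/=; have [->|yn0] := eqVneq y 0%R; first by rewrite log20.
  by rewrite log2_EFin// lt_neqAle eq_sym yn0.
have {}x0 : (0 < x)%R by rewrite lt_neqAle eq_sym xn0.
have [->|yn0] := eqVneq y 0%R; first by rewrite mule0 log20 log2_EFin.
have {}y0 : (0 < y)%R by rewrite lt_neqAle eq_sym yn0.
rewrite -EFinM !log2_EFin ?mulr_gt0// lnM// -EFinN -EFinB; congr EFin.
by rewrite mulrDl opprD.
Qed.

Lemma joint_shannonE {n : nat} (P : 'I_n -> probability BR R) (A : set BR) :
  measurable A -> joint_shannon P A = - log2 (\prod_(i < n) P i A).
Proof.
move=> mA; rewrite /joint_shannon; elim: (index_enum _) => [|i s ih].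
  by rewrite !big_nil log2_EFin// ln1 mul0r oppe0.
rewrite !big_cons ih log2M//.
  by rewrite measure_ge0 ltey_eq fin_num_measure.
by rewrite prode_ge0//= ltey_eq prode_fin_num// => k _; rewrite fin_num_measure.
Qed.

(** The loss of an event with product [p] and [Q]-probability [q]. *)
Lemma ler_log2_invP c p q : (0 < c)%R -> (0 < p)%R -> (0 < q)%R ->
  (- log2 p%:E - - log2 q%:E <= log2 c^-1%:E) = (c * q <= p)%R.
Proof.
move=> c0 p0 q0; rewrite oppeK !log2_EFin ?invr_gt0// -EFinN -EFinD lee_fin.
rewrite -mulNr -mulrDl ler_pM2r ?invr_gt0// lnV ?posrE// lerNr opprD opprK.
by rewrite -lerBlDr opprK -lnM ?posrE// ler_ln ?posrE ?mulr_gt0.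
Qed.

(** The maximum loss is at most [log2 (1 / c)] exactly when [c Q] is dominated
    by the product set function.  Taking the whole space shows that either
    condition forces [c <= 1]; this covers the events where both sides vanish. *)
Lemma max_loss_le_log2 {n : nat} (P : 'I_n -> probability BR R)
    (Q : probability BR R) c : (0 < c)%R ->
  max_loss Q P <= log2 c^-1%:E <->
  (forall A, measurable A -> c%:E * Q A <= \prod_(i < n) P i A).
Proof.
move=> c0.
have finP A : measurable A -> \prod_(i < n) P i A \is a fin_num.
  by move=> mA; apply: prode_fin_num => i _; exact: fin_num_measure.
have P0 A : 0 <= \prod_(i < n) P i A by apply: prode_ge0.
split=> [QP A mA|QP].
- have : shannon_loss Q P A <= log2 c^-1%:E.
    by apply: le_trans QP; apply: ereal_sup_ubound; exists A.
  have [Q0|Qn0] := eqVneq (Q A) 0; first by rewrite Q0 mule0.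
  rewrite /shannon_loss (negbTE Qn0) andbF joint_shannonE// /shannon.
  have Q0 : 0 <= Q A by []; have finQ : Q A \is a fin_num.
    exact: fin_num_measure.
  move: (Q A) (\prod_(i < n) P i A) Qn0 Q0 finQ (P0 A) (finP A mA).
  case=> [q| |]// [p| |]// qn0 q0 _ p0 _; rewrite !lee_fin in q0 p0.
  have {}q0 : (0 < q)%R by rewrite lt_neqAle eq_sym qn0.
  move: p0; rewrite [(0 <= p)%R]le_eqVlt => /predU1P[<-|p0].
    by rewrite log20 !log2_EFin ?invr_gt0.
  by rewrite ler_log2_invP// -EFinM lee_fin.
- apply: ge_ereal_sup => _ [A mA <-].
  have := QP _ mA.
  have c1 : (c <= 1)%R.
    have := QP setT measurableT; rewrite probability_setT mule1.
    under eq_bigr do rewrite probability_setT.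
    by rewrite big1_eq lee_fin.
  rewrite /shannon_loss joint_shannonE// /shannon.
  have Q0 : 0 <= Q A by []; have finQ : Q A \is a fin_num.
    exact: fin_num_measure.
  move: (Q A) (\prod_(i < n) P i A) Q0 finQ (P0 A) (finP A mA).
  case=> [q| |]// [p| |]// q0 _ p0 _; rewrite !lee_fin in q0 p0.
  rewrite -EFinM lee_fin.
  move: p0; rewrite [(0 <= p)%R]le_eqVlt => /predU1P[<-|p0].
    rewrite eqxx/= pmulr_rle0// => qle0.
    have -> : q = 0%R by apply/eqP; rewrite eq_le qle0.
    rewrite eqxx/= log2_EFin ?invr_gt0// lee_fin.
    by rewrite divr_ge0// ?(ltW ln2_gt0)// ln_ge0// invf_ge1.
  rewrite eqe gt_eqF//=; move: q0; rewrite [(0 <= q)%R]le_eqVlt => /predU1P[<-|q0] cqp.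
    by rewrite log20 oppeK log2_EFin//= leNye.
  by rewrite ler_log2_invP.
Qed.

End information.

(** * The conflation and its loss *)

Section conflation.
Context {R : realType} {n : nat} (P : 'I_n -> probability (measurableTypeR R) R).
Local Notation BR := (measurableTypeR R).
Hypothesis n_gt0 : (0 < n)%N.
Hypothesis mass_gt0 : 0 < mass (mu_infty P).

Local Notation m := (fine (mass (mu_infty P))).

(** The default value of [mu_infty] is the null measure, so positive mass means
    that the vague limit exists. *)
Lemma vague_cvg_mu_infty : vague_cvg (mu_dyadic P) (mu_infty P).
Proof.
move: mass_gt0; rewrite /mu_infty; case: xgetP => [mu _ //|_].
by rewrite /mass /= /mzero ltxx.
Qed.

Lemma mass_mu_inftyE : mass (mu_infty P) = m%:E.
Proof. by rewrite fineK//; exact: fin_num_measure. Qed.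

Lemma fine_mass_gt0 : (0 < m)%R.
Proof. by rewrite -lte_fin -mass_mu_inftyE. Qed.

Lemma normalized_mu_infty_is_conflation :
  exists2 Q, is_conflation P Q & forall A, Q A = m^-1%:E * mu_infty P A.
Proof.
have m0 := fine_mass_gt0.
pose k := NngNum (inv_mass_ge0 (mu_infty P)).
have scaleT : mscale k (mu_infty P) setT = 1.
  rewrite /mscale/= -/(mass _) [in X in _ * X]mass_mu_inftyE.
  by rewrite -EFinM mulVf// gt_eqF.
pose Q : probability BR R := HB.pack (mscale k (mu_infty P))
  (Measure_isProbability.Build _ _ _ (mscale k (mu_infty P)) scaleT).
exists Q => //.
apply: (@vague_cvg_normalized _ (mu_dyadic P) (mu_infty P)).
- by rewrite mass_gt0 mass_mu_inftyE ltry.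
- exact: (cvg_mass_mu_dyadic vague_cvg_mu_infty).
- exact: vague_cvg_mu_infty.
Qed.

(** The conflation is the limit measure divided by its mass. *)
Lemma conflationE A : measurable A ->
  m%:E * conflation P A = mu_infty P A.
Proof.
move=> mA; have [Q PQ QE] := normalized_mu_infty_is_conflation.
have PC : is_conflation P (conflation P) by apply: getPex; exists Q.
have -> : conflation P A = Q A by exact: (vague_cvg_unique PC PQ mA).
rewrite QE muleA -EFinM divff ?mul1e//.
by rewrite gt_eqF// fine_mass_gt0.
Qed.

Lemma le_mu_infty (Q : probability BR R) (c : R) : (0 <= c)%R ->
  (forall A, measurable A -> c%:E * Q A <= \prod_(i < n) P i A) ->
  forall A, measurable A -> c%:E * Q A <= mu_infty P A.
Proof.
move=> c0 QP; apply: (le_vague_limit vague_cvg_mu_infty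
  (nu := mscale (NngNum c0) Q)) => j k.
by apply: QP; exact: measurable_cell.
Qed.

End conflation.

Theorem theorem4p3 (R : realType) (n : nat)
    (P : 'I_n -> probability (measurableTypeR R) R)
    (n_gt0 : (0 < n)%N)
    (mass_gt0 : 0 < mass (mu_infty P)) :
  conflation_exists P /\
  (forall Q : probability (measurableTypeR R) R,
    log2 (mass (mu_infty P))^-1 <= max_loss Q P) /\
  (forall Q : probability (measurableTypeR R) R,
    max_loss Q P = log2 (mass (mu_infty P))^-1 <->
    (forall A : set (measurableTypeR R), measurable A ->
      Q A = conflation P A)).
Proof.
have m0 := fine_mass_gt0 mass_gt0; have mE := mass_mu_inftyE P.
set m := fine _ in m0 mE.
have invmE : (mass (mu_infty P))^-1 = m^-1%:E by rewrite mE inver gt_eqF.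
have bound Q : log2 (mass (mu_infty P))^-1 <= max_loss Q P.
  rewrite invmE log2_EFin ?invr_gt0//.
  rewrite leNgt; apply/negP => lossQ.
  have ln2 : (0 < ln 2 :> R)%R by rewrite ln_gt0// ltr1n.
  (* [r] is a real bound on the loss, which could a priori be [-oo]; writing it
     as [log2 (1 / c)] gives [c Q <= mu] with [c > m], absurd on the whole line. *)
  have [r lossr rm] : exists2 r : R, max_loss Q P <= r%:E &
      (r < ln m^-1 / ln 2)%R.
    move: lossQ; case: (max_loss Q P) => [r| |]//.
      by rewrite lte_fin; exists r.
    by exists (ln m^-1 / ln 2 - 1)%R; rewrite ?leNye// ltrBlDr ltrDl.
  pose c := expR (- (r * ln 2)).
  have c0 : (0 < c)%R by exact: expR_gt0.
  have rE : r%:E = log2 c^-1%:E.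
    by rewrite log2_EFin ?invr_gt0// -expRN opprK expRK mulfK// gt_eqF.
  rewrite rE in lossr.
  have /(max_loss_le_log2 P Q c0) cQ := lossr.
  have := le_mu_infty mass_gt0 (ltW c0) cQ measurableT.
  rewrite probability_setT mule1 -/(mass _) mE lee_fin leNgt => /negP; apply.
  rewrite -[m]lnK ?posrE// ltr_expR ltrNr -lnV ?posrE//.
  by rewrite -ltr_pdivlMr.
have [C PC _] := normalized_mu_infty_is_conflation n_gt0 mass_gt0.
split; first by exists C.
split=> // Q; split=> [lossQ|QC].
  have mQ : forall A, measurable A -> m%:E * Q A <= \prod_(i < n) P i A.
    by apply/(max_loss_le_log2 P Q m0); rewrite lossQ invmE.
  have QleC A : measurable A -> Q A <= conflation P A.
    move=> mA; rewrite -(@lee_pmul2l _ m%:E)// conflationE//.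
    exact: (le_mu_infty mass_gt0 (ltW m0) mQ).
  (* The reverse inequality comes from the complement. *)
  move=> A mA; apply/eqP; rewrite eq_le QleC//=.
  have := QleC _ (measurableC mA).
  by rewrite !probability_setC// leeD2lE// leeN2.
apply/eqP; rewrite eq_le bound andbT invmE; apply/(max_loss_le_log2 P Q m0).
move=> A mA; rewrite QC// conflationE//.
exact: (vague_limit_le_prod (vague_cvg_mu_infty mass_gt0) n_gt0 mA).
Qed.
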